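(* For every integer $d \geq 3$, $\mathsf{s}_6(\mathbb{Z}_2^d) = \beta_6(d) + 1$.
   Context: $\mathsf{s}_{6}(\mathbb{Z}_2^d)$ denotes the smallest integer $s$ such that every sequence (repetitions allowed) of length $s$ of elements of $\mathbb{Z}_2^d$ has a subsequence of length $6$ whose elements sum to $0$. $\beta_6(d)$ denotes the largest size of a set $A \subseteq \mathbb{Z}_2^d$ (of distinct elements) with no $6$-element subset summing to $0$. *)

(* Defs.v *)
From mathcomp Require Import all_boot all_order all_algebra.
Set Implicit Arguments.
Unset Strict Implicit.
Unset Printing Implicit Defensive.
Import GRing.Theory.
Local Open Scope ring_scope.

(* A subsequence is given by the set J of its positions, so that terms are
   counted with multiplicity. *)
Definition has_zero_sum6 (d s : nat) (x : s.-tuple 'rV['F_2]_d) : bool :=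
  [exists J : {set 'I_s}, (#|J| == 6) && (\sum_(j in J) tnth x j == 0)].

Definition forces_zero_sum6 (d s : nat) : bool :=
  [forall x : s.-tuple 'rV['F_2]_d, has_zero_sum6 x].

(* By pigeonhole, in a sequence of length 6 * 2 ^ d some vector occurs at
   least 6 times. *)
Lemma forces_zero_sum6_ex (d : nat) : exists s, forces_zero_sum6 d s.
Proof.
exists (6 * #|{: 'rV['F_2]_d}|)%N; apply/forallP => x.
set n := (6 * _)%N in x *.
have [v hv] : exists v, (6 <= #|[set j | tnth x j == v]|)%N.
  apply/existsP; apply: contraT; rewrite negb_exists => /forallP h.
  have : (n <= \sum_(v : 'rV['F_2]_d) 5)%N.
    rewrite -[leqLHS]card_ord -sum1_card.
    rewrite (partition_big (tnth x) predT) //=.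
    apply: leq_sum => v _; rewrite sum1_card -ltnS ltnNge.
    by have := h v; rewrite cardsE.
  rewrite sum_nat_const mulnC leq_pmul2r //.
  by apply/card_gt0P; exists 0.
have [J sJ /eqP cJ] : exists2 J : {set 'I_n},
    J \subset [set j | tnth x j == v] & #|J| == 6.
  have /card_geqP [s [us ss hs]] := hv.
  exists [set j in s]; last by rewrite cardsE (card_uniqP us) ss.
  by apply/subsetP => j; rewrite inE => /hs.
apply/existsP; exists J; rewrite cJ eqxx /=.
rewrite (eq_bigr (fun=> v)); last first.
  by move=> j /(subsetP sJ); rewrite inE => /eqP.
rewrite sumr_const cJ; apply/eqP/rowP => i; rewrite mulmxnE mxE.
by case: (v _ i) => [[|[|k]] hk] //; apply/val_inj.
Qed.

Definition s6 (d : nat) : nat := ex_minn (forces_zero_sum6_ex d).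

Definition zero_sum6_free (d : nat) (A : {set 'rV['F_2]_d}) : bool :=
  [forall B : {set 'rV['F_2]_d},
     (B \subset A) && (#|B| == 6) ==> (\sum_(v in B) v != 0)].

Definition beta6 (d : nat) : nat :=
  \max_(A : {set 'rV['F_2]_d} | zero_sum6_free A) #|A|.

(* Main.v *)
(* A 6-zero-sum-free sequence with a repeated term contains, after the removal
   of two pairs of terms, a set T without zero-sum subsets of size 4 or 6, and
   |T| is the length of the sequence minus 4.  It then suffices to construct a
   6-zero-sum-free set of size |T| + 4.  If |T| >= 6, some affine hyperplane
   contains a part M of T with 2|M| >= |T| + 4, and for u not parallel to this
   hyperplane the union of M and M + u is 6-zero-sum-free.  If |T| <= 5, the set
   F_2^3 extended by d - 3 independent vectors, of size d + 5, is large enough;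
   |T| = 5 with d = 3 is impossible, as the 10 sums of pairs would be distinct. *)
Require Import Defs.
From mathcomp Require Import all_boot all_order all_algebra zify.

Set Implicit Arguments.
Unset Strict Implicit.
Unset Printing Implicit Defensive.
Import GRing.Theory.
Local Open Scope ring_scope.

(** * Characteristic 2 and symmetric differences *)

Lemma addvv d (x : 'rV['F_2]_d) : x + x = 0.
Proof.
rewrite -[x]scale1r -scalerDl (_ : 1 + 1 = 0 :> 'F_2) ?scale0r //.
exact/val_inj.
Qed.

Lemma oppv d (x : 'rV['F_2]_d) : - x = x.
Proof. by apply/eqP; rewrite eq_sym -addr_eq0 addvv. Qed.

Lemma addv_eq0 d (x y : 'rV['F_2]_d) : (x + y == 0) = (x == y).
Proof. by rewrite addr_eq0 oppv. Qed.

Lemma F2_neq0 (a : 'F_2) : a != 0 -> a = 1.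
Proof. by case: a => [[|[|k]]] // hk _; apply/val_inj. Qed.

Lemma F2_natr n : n%:R = (odd n)%:R :> 'F_2.
Proof.
rewrite -[in LHS](odd_double_half n) natrD -mul2n natrM.
by rewrite (_ : 2%:R = 0 :> 'F_2) ?mul0r ?addr0 //; apply/val_inj.
Qed.

Lemma mulvn d (x : 'rV['F_2]_d) n : x *+ n = if odd n then x else 0.
Proof. by rewrite -scaler_nat F2_natr; case: odd; rewrite ?scale1r ?scale0r. Qed.

Lemma card_rVF2 r : #|{: 'rV['F_2]_r}| = (2 ^ r)%N.
Proof. by rewrite card_mx card_Fp // mul1n. Qed.

Lemma card_symdiff (X : finType) (A B : {set X}) :
  (#|(A :\: B) :|: (B :\: A)| + 2 * #|A :&: B| = #|A| + #|B|)%N.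
Proof.
have dis : (A :\: B) :&: (B :\: A) = set0.
  by apply/setP=> v; rewrite !inE; case: (v \in A); rewrite ?andbF.
have := cardsID A B; have := cardsID B A; rewrite cardsU dis cards0 setIC.
lia.
Qed.

Lemma symdiff_eq0 (X : finType) (A B : {set X}) :
  (A :\: B) :|: (B :\: A) = set0 -> A = B.
Proof.
move/eqP; rewrite setU_eq0 !setD_eq0 => /andP[sAB sBA].
by apply/eqP; rewrite eqEsubset sAB.
Qed.

Lemma symdiff_sub (X : finType) (A B T : {set X}) :
  A \subset T -> B \subset T -> (A :\: B) :|: (B :\: A) \subset T.
Proof. by move=> sA sB; rewrite subUset !subDset !subsetU // ?sA ?sB ?orbT. Qed.

(** The common elements are counted twice and cancel. *)
Lemma sum_symdiff d (A B : {set 'rV['F_2]_d}) :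
  \sum_(v in A) v + \sum_(v in B) v = \sum_(v in (A :\: B) :|: (B :\: A)) v.
Proof.
rewrite (big_setID B) /= (big_setID (I := _) (A := B) A) /= setIC.
rewrite addrACA addvv add0r [RHS](big_setID A) /=.
by congr (_ + _); apply: eq_bigl => v; rewrite !inE; case: (v \in A); case: (v \in B).
Qed.

(** * Zero-sum-free sets and [beta6] *)

Lemma zero_sum6_freeP d (A : {set 'rV['F_2]_d}) :
  reflect (forall B : {set 'rV_d}, B \subset A -> #|B| = 6%N -> \sum_(v in B) v <> 0)
          (zero_sum6_free A).
Proof.
apply: (iffP forallP) => [fA B sB cB|fA B].
  by have := fA B; rewrite sB cB => /eqP.
by apply/implyP => /andP[sB /eqP cB]; apply/eqP; apply: fA.
Qed.

Lemma has_zero_sum6P d s (x : s.-tuple 'rV['F_2]_d) :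
  reflect (exists2 J : {set 'I_s}, #|J| = 6%N & \sum_(j in J) tnth x j = 0)
          (has_zero_sum6 x).
Proof.
apply: (iffP existsP) => -[J]; first by move=> /andP[/eqP cJ /eqP sJ]; exists J.
by move=> cJ sJ; exists J; rewrite cJ sJ !eqxx.
Qed.

Lemma zero_sum6_free_beta6 d (A : {set 'rV['F_2]_d}) :
  zero_sum6_free A -> (#|A| <= beta6 d)%N.
Proof. exact: (@leq_bigmax_cond _ _ (fun A : {set _} => #|A|)). Qed.

Lemma beta6_witness d :
  exists2 A : {set 'rV['F_2]_d}, zero_sum6_free A & #|A| = beta6 d.
Proof.
have free0 : zero_sum6_free (set0 : {set 'rV['F_2]_d}).
  by apply/zero_sum6_freeP => B; rewrite subset0 => /eqP->; rewrite cards0.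
have [|A fA eA] := @eq_bigmax_cond _ (mem (@zero_sum6_free d)) (fun A : {set _} => #|A|).
  by apply/card_gt0P; exists set0.
by exists A; rewrite ?eA.
Qed.

(** * Hyperplanes over F_2 *)

Lemma mulmx_eq1 r (c : 'cV['F_2]_r) : c != 0 -> exists e : 'rV_r, e *m c = 1.
Proof.
rewrite -trmx_eq0 => /rV0Pn[i]; rewrite mxE => /F2_neq0 ci; exists (delta_mx 0 i); rewrite -rowE.
by apply/matrixP=> ? ?; rewrite !ord1 mxE ci mxE.
Qed.

Lemma F2_mx11 (x : 'M['F_2]_1) : (x == 1) = (x != 0).
Proof.
case: eqP => [->|x1]; first by rewrite oner_eq0.
apply/esym/negbTE; rewrite negbK; apply/eqP/matrixP=> i j; rewrite !ord1 mxE.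
apply/eqP; apply: contraPT (erefl true) => /F2_neq0 x00 _; case: x1.
by apply/matrixP => ? ?; rewrite !ord1 x00 mxE.
Qed.

(** Translation by a vector [e] with [e *m c = 1] exchanges the kernel of [c] and its complement. *)
Lemma card_orth r (c : 'cV['F_2]_r) : c != 0 ->
  (2 * #|[set f : 'rV_r | f *m c == 0%R]| = 2 ^ r)%N.
Proof.
move=> /mulmx_eq1[e ec].
set N := [set f | _].
have eN : [set f + e | f in N] = ~: N.
  apply/setP => f; rewrite !inE; apply/imsetP/idP => [[g]|f1].
    by rewrite inE => /eqP g0 ->; rewrite mulmxDl g0 add0r ec oner_eq0.
  by exists (f - e); rewrite ?addrNK // inE mulmxBl ec subr_eq0 F2_mx11.
have := cardsC N; rewrite -eN card_imset; last exact: addIr.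
by rewrite addnn -mul2n => ->; rewrite card_rVF2.
Qed.

(* Averaging over all functionals [f], including 0, which only sees that a
   nonzero vector is orthogonal to half of them. *)
Lemma large_hyperplane r (S : {set 'rV['F_2]_r}) : 0 \in S -> (1 < #|S|)%N ->
  exists2 f : 'rV_r, f != 0 & (#|S| <= 2 * #|[set z in S | f *m z^T == 0%R]|)%N.
Proof.
move=> S0 S1; apply/exists_inP; apply: contraT => /exists_inPn h.
have leS : (#|S| <= 2 ^ r)%N.
  by rewrite -card_rVF2 max_card.
pose n (f : 'rV['F_2]_r) := #|[set z in S | f *m z^T == 0]|.
(* Double counting: [z = 0] is orthogonal to all functionals, every other [z] in [S] to half of
   them. *)
have sumn : (2 * \sum_f n f = 2 * 2 ^ r + #|S|.-1 * 2 ^ r)%N.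
  under eq_bigr => f _.
    rewrite /n -sum1_card; under eq_bigl => z do rewrite inE.
    rewrite big_mkcondr; over.
  rewrite exchange_big /= (bigD1 0) //= mulnDr; congr (_ + _)%N.
    under eq_bigr do rewrite trmx0 mulmx0 eqxx.
    by rewrite sum1_card card_rVF2.
  rewrite big_distrr /= (eq_bigr (fun=> 2 ^ r))%N; last first.
    move=> z /andP[_ z0]; rewrite -big_mkcond sum1_card -cardsE card_orth //.
    by rewrite -trmx_eq0 trmxK.
  rewrite sum_nat_const; congr (_ * _)%N.
  rewrite (cardsD1 0 S) S0 /=; apply: eq_card => z.
  by rewrite !inE andbC.
have : (2 * \sum_f n f <= 2 * #|S| + (2 ^ r).-1 * #|S|.-1)%N.
  rewrite big_distrr /= (bigD1 0) //= leq_add //.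
    by rewrite leq_pmul2l // subset_leq_card //; apply/subsetP => z; rewrite inE => /andP[].
  apply: leq_trans (_ : \sum_(f | f != 0%R :> 'rV['F_2]_r) #|S|.-1 <= _)%N.
    apply: leq_sum => f /h; rewrite -ltnNge => hf.
    by rewrite -ltnS prednK // (ltnW S1).
  by rewrite sum_nat_const leq_mul2r cardC1 card_rVF2 leqnn orbT.
(* Together these give [2 * 2 ^ r <= #|S| + 1], against [1 < #|S| <= 2 ^ r]. *)
rewrite sumn; nia.
Qed.

(** * Sets without short even zero sums, and doubling *)

(** Two distinct vectors never sum to 0, so this excludes exactly the zero-sum subsets of size 4 or
    6; the form in terms of even sizes suits symmetric differences. *)
Definition indep6 d (T : {set 'rV['F_2]_d}) :=
  forall D : {set 'rV['F_2]_d}, D \subset T -> ~~ odd #|D| -> (#|D| <= 6)%N ->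
  \sum_(v in D) v = 0 -> D = set0.

Lemma indep6_inj d (T A B : {set 'rV['F_2]_d}) : indep6 T ->
  A \subset T -> B \subset T -> ~~ odd (#|A| + #|B|) -> (#|A| + #|B| <= 6)%N ->
  \sum_(v in A) v = \sum_(v in B) v -> A = B.
Proof.
move=> iT sA sB oAB AB6 /eqP; rewrite -addv_eq0 sum_symdiff => /eqP sAB.
have cs := card_symdiff A B; apply/symdiff_eq0/iT; rewrite ?symdiff_sub //.
  by move: oAB; rewrite -cs oddD mul2n odd_double addbF.
by rewrite (leq_trans _ AB6) // -cs leq_addr.
Qed.

(* [M] lies in an affine hyperplane not parallel to [u]; six elements of
   [M :|: (M + u)] with sum 0 contain an even number of elements of [M + u], and
   the elements of [M] below them that do not cancel violate [indep6 M]. *)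
Lemma doubling d (M : {set 'rV['F_2]_d}) (f : 'cV['F_2]_d) c :
  indep6 M -> f != 0 -> (forall z, z \in M -> z *m f = c) ->
  (2 * #|M| <= beta6 d)%N.
Proof.
move=> iM f0 fM.
have [u uf] := mulmx_eq1 f0.
have inj1 : injective (fun v => v + u) := addIr u.
pose M1 := [set v + u | v in M].
have MM1 z : z \in M -> z \in M1 -> False.
  move=> zM /imsetP[y yM ez]; have := fM _ zM.
  rewrite ez mulmxDl fM // uf -[RHS]addr0 => /addrI /matrixP/(_ 0 0).
  by rewrite !mxE.
have cM : #|M :|: M1| = (2 * #|M|)%N.
  have MM0 : M :&: M1 = set0.
    by apply/setP=> z; rewrite !inE; apply/andP => -[/MM1 h /h].
  by rewrite cardsU MM0 cards0 subn0 card_imset // mul2n addnn.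
rewrite -cM; apply: zero_sum6_free_beta6; apply/zero_sum6_freeP => B sB cB B0.
pose P := B :&: M; pose Q := [set v in M | v + u \in B].
have BPQ : B = P :|: [set v + u | v in Q].
  apply/setP=> z; rewrite !inE; apply/idP/orP.
    move=> zB; have := subsetP sB _ zB; rewrite inE => /orP[zM|]; first by left; rewrite zB.
    by case/imsetP=> v vM ez; right; apply/imsetP; exists v; rewrite // inE vM -ez.
  by case=> [/andP[]//|/imsetP[v]]; rewrite inE => /andP[_ ?] ->.
have dis : [disjoint P & [set v + u | v in Q]].
  rewrite -setI_eq0; apply/eqP/setP => z; rewrite !inE.
  apply/andP => -[/andP[_ /MM1 h] /imsetP[v]]; rewrite inE => /andP[vM _] ez.
  by apply: h; apply/imsetP; exists v.
have cPQ : (#|P| + #|Q| = 6)%N.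
  by rewrite -cB BPQ cardsU (disjoint_setI0 dis) cards0 subn0 card_imset.
have sPQ : \sum_(v in P) v + \sum_(v in Q) v + u *+ #|Q| = 0.
  apply: etrans B0; rewrite [in RHS]BPQ.
  rewrite [RHS](eq_bigl [predU P & [set v + u | v in Q]]) => [|v]; last by rewrite !inE.
  rewrite bigU //= big_imset /=; last exact: in2W.
  by rewrite big_split /= sumr_const addrA.
have sPM : P \subset M by apply: subsetIr.
have sQM : Q \subset M by apply/subsetP => v; rewrite inE => /andP[].
have sumf (A : {set 'rV_d}) : A \subset M -> (\sum_(v in A) v) *m f = c *+ #|A|.
  move=> sA; rewrite mulmx_suml -sumr_const; apply: eq_bigr => v vA.
  by rewrite fM // (subsetP sA).
(* Under [f], the six base points contribute [c *+ 6 = 0], which leaves [#|Q|] modulo 2. *)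
have oQ : ~~ odd #|Q|.
  have /(congr1 (mulmx^~ f)) := sPQ.
  rewrite !mulmxDl !sumf // -mulrnDr cPQ mul0mx mulvn add0r mulvn.
  case: odd => //; rewrite uf => /matrixP/(_ 0 0).
  by rewrite !mxE.
have ePQ : P = Q.
  apply: (indep6_inj iM); rewrite ?cPQ //; apply/eqP.
  by rewrite -addv_eq0; move: sPQ; rewrite mulvn (negPf oQ) addr0 => ->.
(* [P = Q] forces [#|Q| = 3], which is odd. *)
by move: oQ cPQ; rewrite ePQ; case: #|Q| => [|[|[|[|]]]] //= n _; lia.
Qed.

(** * A hyperplane with many points *)

Lemma subset_of_card (X : finType) (A : {set X}) n : (n <= #|A|)%N ->
  exists2 K : {set X}, K \subset A & #|K| = n.
Proof.
move=> nA; have /card_gt0P[K] : (0 < #|[set K : {set X} | K \subset A & #|K| == n]|)%N.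
  by rewrite cards_draws bin_gt0.
by rewrite inE => /andP[sK /eqP cK]; exists K.
Qed.

(** Coefficients in F_2 are 0 or 1, so linear combinations are subset sums. *)
Lemma sub_span_F2 d (K : {set 'rV['F_2]_d}) (h : 'rV['F_2]_d -> 'rV['F_2]_d) z :
  (z <= \sum_(a in K) <<h a>>)%MS ->
  exists2 L : {set 'rV_d}, L \subset K & z = \sum_(a in L) h a.
Proof.
move=> /sub_sumsmxP[u ->]; exists [set a in K | u a *m <<h a>>%MS != 0].
  by apply/subsetP => a; rewrite inE => /andP[].
rewrite (bigID (fun a => u a *m <<h a>>%MS == 0)) /= big1 => [|a /andP[_ /eqP]//].
rewrite add0r; apply: eq_big => [a|a /andP[_]]; first by rewrite inE.
have /sub_rVP[k ->] : (u a *m <<h a>> <= h a)%MS.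
  by rewrite (submx_trans (submxMl _ _)) // genmxE.
by rewrite scaler_eq0 negb_or => /andP[/F2_neq0-> _]; rewrite scale1r.
Qed.

(* Modulo the span of the translates [a + a0] of four points [a] of [T], the
   other points remain distinct; a hyperplane containing these four points and
   half of the others is then provided by [large_hyperplane]. *)
Lemma indep6_hyperplane d (T : {set 'rV['F_2]_d}) : indep6 T -> (6 <= #|T|)%N ->
  exists f : 'cV['F_2]_d, exists2 c, f != 0 &
    (#|T| + 4 <= 2 * #|[set z in T | z *m f == c]|)%N.
Proof.
move=> iT T6; have /card_gt0P[a0 a0T] : (0 < #|T|)%N by apply: leq_trans T6.
have [K sK cK] : exists2 K : {set 'rV_d}, K \subset T :\ a0 & #|K| = 4%N.
  by apply: subset_of_card; move: T6; rewrite (cardsD1 a0) a0T => /ltnW.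
have KT : K \subset T by apply: subset_trans sK (subsetDl _ _).
have a0K : a0 \notin K by apply/negP => /(subsetP sK); rewrite !inE eqxx.
have cTK : (#|T :\: K| = #|T| - 4)%N by rewrite cardsD (setIidPr KT) cK.
(* [C] is the quotient map by [P] in coordinates: its kernel is [P], and its full rank later makes
   [g] nonzero. *)
pose P := (\sum_(a in K) <<a + a0>>)%MS; pose C := col_base (cokermx P).
have kerC (z : 'rV_d) : (z *m C == 0) = (z <= P)%MS.
  have eC : z *m cokermx P = z *m C *m row_base (cokermx P).
    by rewrite -mulmxA mulmx_base.
  rewrite submxE eC; apply/eqP/eqP => [->|]; first by rewrite mul0mx.
  rewrite -(mul0mx 1 (row_base (cokermx P))).
  by move=> /row_free_inj; apply; apply: row_base_free.
have injC : {in T :\: K &, injective (fun z => (z + a0) *m C)}.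
  move=> z z'; rewrite !inE => /andP[zK zT] /andP[z'K z'T] /eqP.
  rewrite -subr_eq0 -mulmxBl opprD addrACA subrr addr0 oppv kerC.
  move=> /sub_span_F2[L sL]; rewrite big_split /= sumr_const mulvn => ez.
  have [//|zz'] := eqVneq z z'.
  have LT : L \subset T := subset_trans sL KT.
  have zL : z \notin L by apply: contra zK; apply: (subsetP sL).
  have z'L : z' \notin L by apply: contra z'K; apply: (subsetP sL).
  have a0L : a0 \notin L by apply: contra a0K; apply: (subsetP sL).
  have L4 : (#|L| <= 4)%N by rewrite -cK subset_leq_card.
  have no (D : {set 'rV_d}) x : D \subset T -> ~~ odd #|D| -> (#|D| <= 6)%N ->
      \sum_(v in D) v = 0 -> x \in D -> False.
    by move=> sD oD D6 sumD; rewrite (iT D) ?inE.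
  (* [z + z'] is the sum of [L], plus [a0] if [#|L|] is odd. Hence [L] with [z] and [z'], and also
     [a0] in the odd case, has sum 0; if [z] or [z'] is [a0], these two cancel. The size is even,
     and at most 6 since an odd [#|L|] is at most 3. *)
  move: ez; case: ifP => oL ez; exfalso; last first.
    apply: (no (z |: (z' |: L)) z); rewrite ?inE ?eqxx //.
    - by rewrite !subUset !sub1set zT z'T.
    - by rewrite !cardsU1 !inE negb_or zz' zL z'L /= oL.
    - by rewrite !cardsU1 !inE negb_or zz' zL z'L.
    rewrite !big_setU1 ?inE ?negb_or ?zz' //= addrA.
    by move: ez; rewrite addr0 => <-; rewrite addvv.
  have L3 : (#|L| <= 3)%N by move: oL L4; case: #|L| => [|[|[|[|[|]]]]].
  have [z0|z0] := eqVneq z a0.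
    apply: (no (z' |: L) z'); rewrite ?inE ?eqxx //.
    - by rewrite !subUset !sub1set z'T.
    - by rewrite !cardsU1 z'L /= oL.
    - by rewrite cardsU1 z'L /= add1n ltnS (leq_trans L3).
    rewrite !big_setU1 //=.
    by move: ez; rewrite z0 addrC => /addIr->; rewrite addvv.
  have [z'0|z'0] := eqVneq z' a0.
    apply: (no (z |: L) z); rewrite ?inE ?eqxx //.
    - by rewrite !subUset !sub1set zT.
    - by rewrite !cardsU1 zL /= oL.
    - by rewrite cardsU1 zL /= add1n ltnS (leq_trans L3).
    rewrite !big_setU1 //=.
    by move: ez; rewrite z'0 => /addIr->; rewrite addvv.
  apply: (no (z |: (z' |: (a0 |: L))) z); rewrite ?inE ?eqxx //.
  - by rewrite !subUset !sub1set zT z'T a0T.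
  - by rewrite !cardsU1 !inE !negb_or zz' zL z'L z0 z'0 a0L /= oL.
  - by rewrite !cardsU1 !inE !negb_or zz' zL z'L z0 z'0 a0L /= !add1n !ltnS.
  rewrite !big_setU1 ?inE ?negb_or ?zz' ?z0 ?z'0 //= addrA ez.
  by rewrite [a0 + _]addrC addvv.
pose S := [set (z + a0) *m C | z in T :\: K].
have cS : #|S| = (#|T| - 4)%N by rewrite card_in_imset.
have S0 : 0 \in S.
  by apply/imsetP; exists a0; rewrite ?inE ?a0K // addvv mul0mx.
have S1 : (1 < #|S|)%N by rewrite cS ltn_subRL; apply: leq_trans T6.
have [f f0 leS] := large_hyperplane S0 (S1).
(* The hyperplane is pulled back along [C] and translated to pass through [a0]. *)
pose g := C *m f^T; pose T0 := [set z in T | z *m g == a0 *m g].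
have fg z : (f *m ((z + a0) *m C)^T == 0) = (z *m g == a0 *m g).
  by rewrite -trmx_eq0 trmx_mul trmxK -mulmxA -[RHS]subr_eq0 -mulmxBl oppv.
have KT0 : K \subset T0.
  apply/subsetP => a aK; rewrite inE (subsetP KT) //= -fg.
  suff /eqP-> : (a + a0) *m C == 0 by rewrite trmx0 mulmx0.
  by rewrite kerC (sumsmx_sup a) // genmxE.
rewrite cS in leS; exists g, (a0 *m g).
  apply: contraNneq f0; rewrite /g -(mulmx0 _ C) => /row_full_inj.
  by rewrite -trmx_eq0 => ->; rewrite // col_base_full.
have leT0 : (#|[set z in S | f *m z^T == 0%R]| <= #|T0| - 4)%N.
  rewrite -cK -(setIidPr KT0) -cardsD.
  apply: leq_trans (leq_imset_card (fun z => (z + a0) *m C) _).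
  apply: subset_leq_card; apply/subsetP => y; rewrite inE.
  case/andP=> /imsetP[z]; rewrite inE => /andP[zK zT] ->; rewrite fg => zg.
  by apply/imsetP; exists z; rewrite // !inE zK zT.
(* From [6 <= t] follows [0 < n], so [m - 4] is not truncated. *)
have arith t n m : (6 <= t -> t - 4 <= 2 * n -> n <= m - 4 -> t + 4 <= 2 * m)%N.
  by lia.
exact: arith T6 leS leT0.
Qed.

(** * Lower bounds for [beta6] *)

(** All eight vectors sum to 0, so the two distinct vectors outside a zero-sum 6-set would also sum
    to 0. *)
Lemma zero_sum6_free_setT3 : zero_sum6_free [set: 'rV['F_2]_3].
Proof.
have sumT : \sum_(v : 'rV['F_2]_3) v = 0.
  apply/rowP => i; rewrite summxE mxE.
  pose c : 'cV['F_2]_3 := delta_mx i 0.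
  have c0 : c != 0 by apply/eqP => /matrixP/(_ i 0); rewrite !mxE !eqxx.
  have vc (v : 'rV_3) : (v *m c == 0) = (v 0 i == 0).
    rewrite -colE; apply/eqP/eqP => [/matrixP/(_ 0 0)|vi]; first by rewrite !mxE.
    by apply/matrixP => ? ?; rewrite !ord1 !mxE.
  have arith n m : (n + m = 2 ^ 3 -> 2 * n = 2 ^ 3 -> m = 4)%N by lia.
  have c4 : #|[pred v : 'rV['F_2]_3 | v 0 i != 0]| = 4%N.
    rewrite -(arith _ _ (etrans (cardsC _) (card_rVF2 3)) (card_orth c0)).
    by apply: eq_card => v; rewrite !inE vc.
  rewrite (bigID (fun v : 'rV_3 => v 0 i == 0)) /= big1 => [|v /eqP//].
  rewrite add0r (eq_bigr (fun=> 1)) => [|v /F2_neq0//].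
  by rewrite sumr_const c4; apply/val_inj.
apply/zero_sum6_freeP => B _ cB.
have /cards2P[p [q [pq eB]]] : #|~: B| == 2%N.
  by have := cardsC B; rewrite card_rVF2 cB; lia.
have := sumT; rewrite (bigID (mem B)) /= [X in _ + X](eq_bigl (mem [set p; q])).
  rewrite big_setU1 ?inE //= big_set1 => /eqP.
  by rewrite addv_eq0 => /eqP-> /eqP; rewrite addv_eq0 (negPf pq).
by move=> v; rewrite -eB !inE.
Qed.

(** The new vector [e] is the only one with last coordinate 1, so it lies in no zero-sum subset. *)
Lemma beta6_addn1 d : (beta6 d + 1 <= beta6 (d + 1))%N.
Proof.
have [A fA <-] := beta6_witness d.
pose i (v : 'rV['F_2]_d) : 'rV_(d + 1) := row_mx v 0.
pose e : 'rV['F_2]_(d + 1) := row_mx 0 1.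
have inj_i : injective i by move=> v w /eq_row_mx[].
have e_i v : e != i v.
  by apply/eqP => /eq_row_mx[_ /matrixP/(_ 0 0)]; rewrite !mxE.
have -> : (#|A| + 1 = #|e |: [set i v | v in A]|)%N.
  rewrite cardsU1 card_imset // addnC (_ : e \notin _) //.
  by apply/imsetP => -[v _ /eqP]; rewrite (negPf (e_i v)).
apply: zero_sum6_free_beta6; apply/zero_sum6_freeP => B sB cB B0.
have iB w : w \in B -> w != e -> exists2 v, v \in A & w = i v.
  by move=> /(subsetP sB); rewrite !inE => /orP[->//|/imsetP[v vA ->]]; exists v.
have eB : e \notin B.
  apply/negP => eB; have /(congr1 (@rsubmx _ _ _ _)) := B0.
  rewrite linear_sum (bigD1 e) //= big1 => [|w /andP[wB we]].
    by rewrite addr0 row_mxKr linear0 => /eqP; rewrite oner_eq0.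
  by have [v _ ->] := iB _ wB we; rewrite row_mxKr.
pose B' := [set v | i v \in B].
have eBB' : B = i @: B'.
  apply/setP=> w; apply/idP/imsetP => [wB|[v]]; last by rewrite inE => ? ->.
  have [|v _ ew] := iB _ wB; first by apply: contraNneq eB => <-.
  by exists v; rewrite // inE -ew.
apply: (elimT (zero_sum6_freeP A) fA B').
- apply/subsetP => v; rewrite inE => vB.
  by have [|w wA /inj_i->] := iB _ vB; first by rewrite eq_sym.
- by rewrite -cB eBB' card_imset.
have /(congr1 (@lsubmx _ _ _ _)) := B0.
rewrite linear0 linear_sum eBB' (big_imset _ (in2W inj_i)) /= => S0.
by apply: etrans S0; apply: eq_bigr => v _; rewrite row_mxKl.
Qed.

Lemma beta6_ge d : (3 <= d)%N -> (d + 5 <= beta6 d)%N.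
Proof.
elim: d => // d IH; rewrite leq_eqVlt => /predU1P[<-|d3].
  by apply: leq_trans (zero_sum6_free_beta6 zero_sum6_free_setT3); rewrite cardsT card_rVF2.
by rewrite -addn1 addnAC (leq_trans _ (beta6_addn1 d)) // leq_add2r IH.
Qed.

(** Distinct pairs have distinct sums. *)
Lemma indep6_card d (T : {set 'rV['F_2]_d}) : indep6 T -> ('C(#|T|, 2) <= 2 ^ d)%N.
Proof.
move=> iT; rewrite -cards_draws -card_rVF2.
apply: (@leq_card_in _ _ (fun L : {set 'rV_d} => \sum_(v in L) v)) => L L'.
rewrite !inE => /andP[sL /eqP cL] /andP[sL' /eqP cL'].
by apply: (indep6_inj iT); rewrite ?cL ?cL'.
Qed.

Lemma indep6_beta6 d (T : {set 'rV['F_2]_d}) : (3 <= d)%N -> indep6 T ->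
  (#|T| + 4 <= beta6 d)%N.
Proof.
move=> d3 iT; have [T6|T6] := leqP 6 #|T|.
  have [f [c f0 leT]] := indep6_hyperplane iT T6; apply: leq_trans leT _.
  apply: (doubling (f := f) (c := c)) => // [D sD|z]; last by rewrite inE => /andP[_ /eqP].
  by apply: iT; apply: subset_trans sD _; apply/subsetP => z; rewrite inE => /andP[].
apply: leq_trans (beta6_ge d3).
(* For [d >= 4], [d + 5 >= 9] suffices; for [d = 3], the pair count must exclude [#|T| = 5]. *)
move: d3; rewrite leq_eqVlt => /predU1P[d3|]; last lia.
have := indep6_card iT; move: #|T| T6 => n; rewrite -d3.
by case: n => [|[|[|[|[|[|]]]]]].
Qed.

(** * From sequences to sets *)

Lemma card_injective_le_beta6 d s (x : s.-tuple 'rV['F_2]_d) :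
  injective (tnth x) -> ~ has_zero_sum6 x -> (s <= beta6 d)%N.
Proof.
move=> injx nz; have := card_imset setT injx; rewrite cardsT card_ord => <-.
apply: zero_sum6_free_beta6; apply/zero_sum6_freeP => B sB cB sumB.
have eB : B = tnth x @: (tnth x @^-1: B).
  apply/setP => v; apply/idP/imsetP => [vB|[j]]; last by rewrite inE => ? ->.
  have /imsetP[j _ ej] := subsetP sB _ vB.
  by exists j; rewrite // inE -ej.
apply/nz/has_zero_sum6P; exists (tnth x @^-1: B).
  by rewrite -(card_imset _ injx) -eB.
by apply: etrans sumB; rewrite [in RHS]eB (big_imset _ (in2W injx)).
Qed.

(* Two equal terms complete any four terms with sum 0 to six, so that after
   the removal of two disjoint pairs of equal terms the rest is [indep6]. *)
Lemma repeated_le_beta6 d s (x : s.-tuple 'rV['F_2]_d) i j : (3 <= d)%N ->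
  i != j -> tnth x i = tnth x j -> ~ has_zero_sum6 x -> (s <= beta6 d)%N.
Proof.
move=> d3 ij xij nz.
have [s8|s8] := leqP s 8; first by apply: leq_trans (beta6_ge d3); lia.
have no (J : {set 'I_s}) : #|J| = 6%N -> \sum_(k in J) tnth x k = 0 -> False.
  by move=> cJ sJ; apply/nz/has_zero_sum6P; exists J.
have cij : #|~: [set i; j]| = (s - 2)%N.
  by have := cardsC [set i; j]; rewrite cards2 ij card_ord; lia.
(* If no equal pair remains outside [i] and [j], any two further positions are dropped; otherwise a
   second pair is. A third pair would complete six positions with sum 0. *)
have [J [sJ cJ injJ]] : exists J : {set 'I_s},
    [/\ J \subset ~: [set i; j], #|J| = (s - 4)%N & {in J &, injective (tnth x)}].
  have [/dinjectiveP inj|/dinjectivePn[k kI [l /andP[lk lI] xkl]]] :=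
    boolP (dinjectiveb (tnth x) (mem (~: [set i; j]))).
    have [|J sJ cJ] := @subset_of_card _ (~: [set i; j]) (s - 4); first lia.
    by exists J; split=> //; move=> a b aJ bJ; apply: inj; apply: (subsetP sJ).
  have sub : [set k; l] \subset ~: [set i; j] by rewrite subUset !sub1set kI lI.
  exists (~: [set i; j] :\: [set k; l]); split; first exact: subsetDl.
    by rewrite cardsD (setIidPr sub) cij cards2 eq_sym lk; lia.
  move: kI lI; rewrite !inE !negb_or => /andP[ki kj] /andP[li lj].
  move=> m n; rewrite !inE !negb_or.
  move=> /andP[/andP[mk ml] /andP[mi mj]] /andP[/andP[nk nl] /andP[ni nj]] xmn.
  have [//|mn] := eqVneq m n; case: (no (m |: (n |: (l |: (k |: [set i; j]))))).
    by rewrite !cardsU1 cards1 !inE !negb_or mn ml mk mi mj nl nk ni nj lk li lj ki kj ij.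
  rewrite !big_setU1 ?inE ?negb_or ?mn ?ml ?mk ?mi ?mj ?nl ?nk ?ni ?nj ?lk ?li ?lj ?ki ?kj //=.
  by rewrite big_set1 xij addvv addr0 -xkl addvv addr0 -xmn addvv.
have cT : #|tnth x @: J| = (s - 4)%N by rewrite card_in_imset.
have := @indep6_beta6 _ (tnth x @: J) d3; rewrite cT => le; apply: leq_trans (le _); first lia.
move=> D sD oD D6 sumD; apply/eqP; apply: contraT => D0.
pose L := J :&: tnth x @^-1: D.
have injL : {in L &, injective (tnth x)}.
  by move=> a b; rewrite !inE => /andP[aJ _] /andP[bJ _]; apply: injJ.
have eD : D = tnth x @: L.
  apply/setP=> v; apply/idP/imsetP => [vD|[k]]; last by rewrite !inE => /andP[_ ?] ->.
  have /imsetP[k kJ ek] := subsetP sD _ vD.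
  by exists k; rewrite // !inE kJ -ek.
have cL : #|L| = #|D| by rewrite eD card_in_imset.
have sumL : \sum_(k in L) tnth x k = 0 by apply: etrans sumD; rewrite [in RHS]eD big_imset.
have ijL : (i \notin L) && (j \notin L).
  by apply/andP; split; apply/negP; rewrite inE => /andP[/(subsetP sJ)]; rewrite !inE eqxx ?orbT.
clearbody L.
have [D6'|D6'] := eqVneq #|D| 6%N; first by case: (no L); rewrite ?cL.
have [D4|D4] := eqVneq #|D| 4%N.
  case/andP: ijL => iL jL; case: (no (i |: (j |: L))).
    by rewrite !cardsU1 !inE negb_or ij iL jL cL D4.
  by rewrite !big_setU1 ?inE ?negb_or ?ij //= sumL addr0 xij addvv.
have /cards2P[p [q [pq eD2]]] : #|D| == 2%N.
  rewrite -cards_eq0 in D0; move: D0 oD D6 D6' D4.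
  by case: #|D| => [|[|[|[|[|[|[|]]]]]]].
move: sumD; rewrite eD2 big_setU1 ?inE //= big_set1 => /eqP.
by rewrite addv_eq0 (negPf pq).
Qed.

Theorem theorem8 (d : nat) (hd : (3 <= d)%N) : s6 d = (beta6 d + 1)%N.
Proof.
rewrite /s6; case: ex_minnP => m fm min_m; apply/eqP; rewrite eqn_leq; apply/andP; split.
  apply: min_m; apply/forallP => x; apply: contraT => /negP nx.
  suff : (beta6 d + 1 <= beta6 d)%N by rewrite addn1 ltnn.
  have [/injectiveP inj|/injectivePn[i [j ij xij]]] := boolP (injectiveb (tnth x)).
    exact: card_injective_le_beta6 nx.
  exact: repeated_le_beta6 ij xij nx.
(* If [m <= beta6 d], then [m] elements of an extremal set form a sequence without a zero sum of
   length 6. *)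
rewrite addn1 ltnNge; apply/negP => mb.
have [A fA cA] := beta6_witness d.
have sz : size (take m (enum A)) == m by rewrite size_takel // -cardE cA.
pose x := Tuple sz.
have injx : injective (tnth x).
  by apply/tuple_uniqP; rewrite take_uniq ?enum_uniq.
move/forallP/(_ x): fm => /has_zero_sum6P[J cJ sJ].
apply: (elimT (zero_sum6_freeP A) fA (tnth x @: J)).
- apply/subsetP => v /imsetP[j _ ->].
  by rewrite -mem_enum; apply: mem_take (mem_tnth j x).
- by rewrite card_imset.
by rewrite (big_imset _ (in2W injx)).
Qed.
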